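(* Let $R$ be a commutative artin ring, $\mathcal{C}$ a dualizing $R$-variety, $P=\mathrm{Hom}_{\mathcal{C}}(C,-)$ a finitely generated projective $\mathcal{C}$-module and $\mathcal{I}=\mathrm{Tr}_{P}\mathcal{C}$. Then $\mathcal{I}$ satisfies property (A).
   Context: A Hom-finite $R$-variety is a small additive category in which idempotents split, whose Hom-sets are finitely generated $R$-modules with $R$-bilinear composition. $\mathrm{Mod}(\mathcal{C})$ is the category of additive functors $\mathcal{C}\to\mathbf{Ab}$ and $\mathrm{mod}(\mathcal{C})$ its full subcategory of finitely presented functors. With $E$ the injective envelope of $R/\mathrm{rad}(R)$, put $\mathbb{D}_{\mathcal{C}}(M)(C)=\mathrm{Hom}_R(M(C),E)$ for functors with finitely generated values; $\mathcal{C}$ is dualizing if $\mathbb{D}_{\mathcal{C}}$ induces a duality between $\mathrm{mod}(\mathcal{C})$ and $\mathrm{mod}(\mathcal{C}^{op})$. The trace ideal $\mathrm{Tr}_P\mathcal{C}$ is the ideal of $\mathcal{C}$ given by $(\mathrm{Tr}_P\mathcal{C})(A,B)=\mathrm{Tr}_P(\mathrm{Hom}_{\mathcal{C}}(A,-))(B)$, where $\mathrm{Tr}_P(N)\subseteq N$ is the sum of the images of all morphisms $P\to N$. An ideal $\mathcal{I}$ satisfies property (A) if for every $C'\in\mathcal{C}$ there exist objects $X,Y\in\mathcal{C}$ and epimorphisms $\mathrm{Hom}_{\mathcal{C}}(X,-)\to\mathcal{I}(C',-)\to0$ and $\mathrm{Hom}_{\mathcal{C}}(-,Y)\to\mathcal{I}(-,C')\to0$.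 *)

(* Defs.v *)
From HB Require Import structures.
From mathcomp Require Import all_boot all_algebra.
From mathcomp Require Import boolp.

Set Implicit Arguments.
Unset Strict Implicit.
Unset Printing Implicit Defensive.

Import GRing.Theory.
Local Open Scope ring_scope.
Local Open Scope quotient_scope.

Section Modules.
Variable R : comPzRingType.

(* Ideals of R are the submodules of the regular module R^o. *)
Definition artinian : Prop :=
  forall I : nat -> submodClosed R^o,
    (forall n, {subset I n.+1 <= I n}) ->
    exists n, forall m, (n <= m)%N -> I m =i I n.

Definition maximal_ideal (I : submodClosed R^o) : Prop :=
  (1 : R^o) \notin I /\
  forall J : submodClosed R^o,
    {subset I <= J} -> (1 : R^o) \notin J -> {subset J <= I}.

Definition jacobson : {pred R^o} :=
  fun x => `[< forall I : submodClosed R^o, maximal_ideal I -> x \in I >].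

Lemma jacobson_closed : GRing.subsemimod_closed jacobson.
Proof.
split; first split.
- by apply/asboolP => I _; exact: rpred0.
- move=> x y /asboolP hx /asboolP hy; apply/asboolP => I mI.
  by apply: rpredD; [exact: hx | exact: hy].
- move=> a x /asboolP hx; apply/asboolP => I mI.
  by apply: rpredZ; exact: hx.
Qed.

HB.instance Definition _ :=
  GRing.isSubSemiModClosed.Build R R^o jacobson jacobson_closed.

Definition fin_gen (U : lmodType R) : Prop :=
  exists (n : nat) (u : 'I_n -> U),
    forall x, exists c : 'I_n -> R, x = \sum_(i < n) c i *: u i.

Section Quotient.
Variables (U : lmodType R) (S : submodClosed U).

(* MathComp does not infer that a submodule is closed under opposites. *)
Definition subgrp_of_submod : {pred U} := S.

HB.instance Definition _ := GRing.isZmodClosed.Build U subgrp_of_submod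
  (GRing.submod_closedB (GRing.submodClosedP S)).

Definition lquot : Type := Quotient.quot subgrp_of_submod.

HB.instance Definition _ := GRing.Zmodule.on lquot.

Definition lquot_scale (a : R) (x : lquot) : lquot :=
  \pi_(Quotient.quot subgrp_of_submod) (a *: repr x).

Lemma pi_lquot_scale a (u : U) :
  lquot_scale a (\pi_(Quotient.quot subgrp_of_submod) u) = \pi_(Quotient.quot subgrp_of_submod) (a *: u).
Proof.
apply/(@eqP (Quotient.quot subgrp_of_submod)).
rewrite -Quotient.idealrBE -scalerBr.
have : repr (\pi_(Quotient.quot subgrp_of_submod) u) - u \in subgrp_of_submod.
  by rewrite Quotient.idealrBE reprK.
exact: rpredZ.
Qed.

Lemma lquot_ind (Q : lquot -> Prop) :
  (forall u, Q (\pi_(Quotient.quot subgrp_of_submod) u)) -> forall x, Q x.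
Proof. by move=> h x; rewrite -[x]reprK; exact: h. Qed.

Lemma lquot_scaleA a b v :
  lquot_scale a (lquot_scale b v) = lquot_scale (a * b) v.
Proof. by elim/lquot_ind: v => v; rewrite !pi_lquot_scale scalerA. Qed.

Lemma lquot_scale1 : left_id 1 lquot_scale.
Proof. by elim/lquot_ind => v; rewrite pi_lquot_scale scale1r. Qed.

Lemma lquot_scaleDr : right_distributive lquot_scale +%R.
Proof.
move=> a; elim/lquot_ind => x; elim/lquot_ind => y.
have piD (u v : U) : \pi_(Quotient.quot subgrp_of_submod) u + \pi_(Quotient.quot subgrp_of_submod) v =
  \pi_(Quotient.quot subgrp_of_submod) (u + v) by rewrite !piE.
by rewrite [X in lquot_scale _ X]piD !pi_lquot_scale scalerDr -piD.
Qed.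

Lemma lquot_scaleDl v : {morph lquot_scale^~ v : a b / a + b}.
Proof.
move=> a b; elim/lquot_ind: v => v.
have piD (u w : U) : \pi_(Quotient.quot subgrp_of_submod) u + \pi_(Quotient.quot subgrp_of_submod) w =
  \pi_(Quotient.quot subgrp_of_submod) (u + w) by rewrite !piE.
by rewrite !pi_lquot_scale scalerDl -piD.
Qed.

HB.instance Definition _ := GRing.Zmodule_isLmodule.Build R lquot
  lquot_scaleA lquot_scale1 lquot_scaleDr lquot_scaleDl.

End Quotient.

Definition top_module : lmodType R := lquot jacobson.

Definition injective_module (E : lmodType R) : Prop :=
  forall (U V : lmodType R) (i : {linear U -> V}) (f : {linear U -> E}),
    injective i -> exists g : {linear V -> E}, forall u, g (i u) = f u.

Definition essential (U E : lmodType R) (i : {linear U -> E}) : Prop :=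
  forall S : submodClosed E, (exists2 x, x \in S & x != 0) ->
    exists2 u, i u \in S & i u != 0.

Definition injective_envelope (U E : lmodType R) : Prop :=
  injective_module E /\
  exists i : {linear U -> E}, injective i /\ essential i.

Section LinearDual.
Variables U E : lmodType R.

(* Hom_R(U, E) as an abelian group, under pointwise addition. *)
Definition linhom : Type := {linear U -> E}.

HB.instance Definition _ := gen_eqMixin linhom.
HB.instance Definition _ := gen_choiceMixin linhom.

Lemma linhomP (f g : {linear U -> E}) : f =1 g -> f = g.
Proof.
case: f g => f [[f1] [f2]] [g [[g1] [g2]]] /= /funext fg.
by subst g; congr (GRing.Linear.Pack (GRing.Linear.Class _ _));
  congr (_ _); exact: Prop_irrelevance.
Qed.

Let lin0 : linhom := (\0 : U -> E)%R.
Let linD (f g : linhom) : linhom :=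
  ((f : {linear U -> E}) \+ (g : {linear U -> E}))%R.
Let linN (f : linhom) : linhom := (\- (f : {linear U -> E}))%R.

Let linDA : associative linD.
Proof. by move=> f g h; apply: linhomP => x /=; rewrite addrA. Qed.
Let linDC : commutative linD.
Proof. by move=> f g; apply: linhomP => x /=; rewrite addrC. Qed.
Let lin0D : left_id lin0 linD.
Proof. by move=> f; apply: linhomP => x /=; rewrite add0r. Qed.
Let linND : left_inverse lin0 linN linD.
Proof. by move=> f; apply: linhomP => x /=; rewrite addNr. Qed.

HB.instance Definition _ := GRing.isZmodule.Build linhom linDA linDC lin0D linND.

End LinearDual.
End Modules.

Lemma addhomP (U V : zmodType) (f g : {additive U -> V}) : f =1 g -> f = g.
Proof.
case: f g => f [[f1]] [g [[g1]]] /= /funext fg; subst g.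
by congr (GRing.Additive.Pack (GRing.Additive.Class _));
  congr (_ _); exact: Prop_irrelevance.
Qed.

Record category := Category {
  cobj :> Type;
  chom : cobj -> cobj -> Type;
  cid : forall X, chom X X;
  ccomp : forall X Y Z, chom Y Z -> chom X Y -> chom X Z;
  ccompA : forall W X Y Z (h : chom Y Z) (g : chom X Y) (f : chom W X),
    ccomp h (ccomp g f) = ccomp (ccomp h g) f;
  ccomp1l : forall X Y (f : chom X Y), ccomp (cid Y) f = f;
  ccomp1r : forall X Y (f : chom X Y), ccomp f (cid X) = f
}.

Definition opcat (A : category) : category :=
  @Category A (fun X Y => @chom A Y X) (@cid A)
    (fun X Y Z g f => ccomp f g)
    (fun W X Y Z h g f => esym (ccompA f g h))
    (fun X Y f => ccomp1r f) (fun X Y f => ccomp1l f).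

Definition full_subcat (A : category) (P : A -> Prop) : category :=
  @Category {X : A | P X} (fun X Y => chom (sval X) (sval Y))
    (fun X => cid (sval X)) (fun X Y Z => @ccomp A _ _ _)
    (fun W X Y Z => @ccompA A _ _ _ _)
    (fun X Y => @ccomp1l A _ _) (fun X Y => @ccomp1r A _ _).

Definition epi (A : category) (X Y : A) (f : chom X Y) : Prop :=
  forall (Z : A) (g h : chom Y Z), ccomp g f = ccomp h f -> g = h.

Record functor (A B : category) := Functor {
  fobj :> A -> B;
  fmap : forall X Y, chom X Y -> chom (fobj X) (fobj Y);
  fmap1 : forall X, fmap (cid X) = cid (fobj X);
  fmapM : forall X Y Z (g : chom Y Z) (f : chom X Y),
    fmap (ccomp g f) = ccomp (fmap g) (fmap f)
}.

Definition id_functor (A : category) : functor A A :=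
  @Functor A A id (fun X Y f => f) (fun X => erefl) (fun X Y Z g f => erefl).

Section FunctorComp.
Variables (A B D : category) (G : functor B D) (F : functor A B).

Let comp_fmap X Y (f : chom X Y) : chom (G (F X)) (G (F Y)) :=
  fmap G (fmap F f).

Let comp_fmap1 X : comp_fmap (cid X) = cid (G (F X)).
Proof. by rewrite /comp_fmap !fmap1. Qed.

Let comp_fmapM X Y Z (g : chom Y Z) (f : chom X Y) :
  comp_fmap (ccomp g f) = ccomp (comp_fmap g) (comp_fmap f).
Proof. by rewrite /comp_fmap !fmapM. Qed.

Definition comp_functor : functor A D := Functor comp_fmap1 comp_fmapM.

End FunctorComp.

Definition restr_functor (A B : category) (F : functor A B)
    (P : A -> Prop) (Q : B -> Prop) (PQ : forall X, P X -> Q (F X)) :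
    functor (full_subcat P) (full_subcat Q) :=
  @Functor (full_subcat P) (full_subcat Q)
    (fun X => exist Q (F (sval X)) (PQ _ (svalP X)))
    (fun X Y (f : @chom A _ _) => fmap F f)
    (fun X => fmap1 F (sval X)) (fun X Y Z g f => @fmapM A B F _ _ _ g f).

Definition nat_iso (A B : category) (F G : functor A B) : Prop :=
  exists (eta : forall X, chom (F X) (G X)) (eta' : forall X, chom (G X) (F X)),
    [/\ forall X, ccomp (eta' X) (eta X) = cid (F X),
        forall X, ccomp (eta X) (eta' X) = cid (G X) &
        forall X Y (f : chom X Y),
          ccomp (eta Y) (fmap F f) = ccomp (fmap G f) (eta X)].

Definition equivalence (A B : category) (F : functor A B) : Prop :=
  exists G : functor B A,
    nat_iso (comp_functor G F) (id_functor A) /\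
    nat_iso (comp_functor F G) (id_functor B).

Record lincat (R : comPzRingType) := Lincat {
  obj :> Type;
  hom : obj -> obj -> lmodType R;
  idm : forall X, hom X X;
  comp : forall X Y Z, hom Y Z -> hom X Y -> hom X Z;
  compA : forall W X Y Z (h : hom Y Z) (g : hom X Y) (f : hom W X),
    comp h (comp g f) = comp (comp h g) f;
  comp1l : forall X Y (f : hom X Y), comp (idm Y) f = f;
  comp1r : forall X Y (f : hom X Y), comp f (idm X) = f;
  compPl : forall X Y Z a (g g' : hom Y Z) (f : hom X Y),
    comp (a *: g + g') f = a *: comp g f + comp g' f;
  compPr : forall X Y Z a (g : hom Y Z) (f f' : hom X Y),
    comp g (a *: f + f') = a *: comp g f + comp g f'
}.

Definition op (R : comPzRingType) (C : lincat R) : lincat R :=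
  @Lincat R C (fun X Y => @hom R C Y X) (@idm R C)
    (fun X Y Z g f => comp f g)
    (fun W X Y Z h g f => esym (compA f g h))
    (fun X Y f => comp1r f) (fun X Y f => comp1l f)
    (fun X Y Z a g g' f => compPr a f g g')
    (fun X Y Z a g f f' => compPl a f f' g).

Section Varieties.
Variables (R : comPzRingType) (C : lincat R).

Definition zero_object (Z : C) : Prop :=
  forall X, (forall f : hom X Z, f = 0) /\ (forall f : hom Z X, f = 0).

Definition biproduct (X Y S : C) : Prop :=
  exists (i1 : hom X S) (i2 : hom Y S) (p1 : hom S X) (p2 : hom S Y),
    [/\ comp p1 i1 = idm X, comp p2 i2 = idm Y, comp p1 i2 = 0,
        comp p2 i1 = 0 & comp i1 p1 + comp i2 p2 = idm S].

Definition additive_category : Prop :=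
  (exists Z : C, zero_object Z) /\ (forall X Y : C, exists S, biproduct X Y S).

Definition idempotents_split : Prop :=
  forall (X : C) (e : hom X X), comp e e = e ->
    exists (Y : C) (p : hom X Y) (i : hom Y X),
      comp i p = e /\ comp p i = idm Y.

Definition hom_finite_variety : Prop :=
  [/\ additive_category, idempotents_split & forall X Y : C, fin_gen (hom X Y)].

Lemma compDl (X Y Z : C) (g g' : hom Y Z) (f : hom X Y) :
  comp (g + g') f = comp g f + comp g' f.
Proof. by have := compPl 1 g g' f; rewrite !scale1r. Qed.

Lemma compDr (X Y Z : C) (g : hom Y Z) (f f' : hom X Y) :
  comp g (f + f') = comp g f + comp g f'.
Proof. by have := compPr 1 g f f'; rewrite !scale1r. Qed.

Lemma comp0l (X Y Z : C) (f : hom X Y) : comp (0 : hom Y Z) f = 0.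
Proof. by apply: (addIr (comp 0 f)); rewrite -compDl !add0r. Qed.

Lemma comp0r (X Y Z : C) (g : hom Y Z) : comp g (0 : hom X Y) = 0.
Proof. by apply: (addIr (comp g 0)); rewrite -compDr !add0r. Qed.

Lemma compZl (X Y Z : C) a (g : hom Y Z) (f : hom X Y) :
  comp (a *: g) f = a *: comp g f.
Proof. by have := compPl a g 0 f; rewrite comp0l !addr0. Qed.

Lemma compZr (X Y Z : C) a (g : hom Y Z) (f : hom X Y) :
  comp g (a *: f) = a *: comp g f.
Proof. by have := compPr a g f 0; rewrite comp0r !addr0. Qed.

(* Additive functors from C to abelian groups. *)
Record cmodule := CModule {
  mval :> C -> zmodType;
  mmap : forall X Y, hom X Y -> {additive mval X -> mval Y};
  mmap1 : forall X x, mmap (idm X) x = x;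
  mmapM : forall X Y Z (g : hom Y Z) (f : hom X Y) x,
    mmap (comp g f) x = mmap g (mmap f x);
  mmapD : forall X Y (f g : hom X Y) x, mmap (f + g) x = mmap f x + mmap g x
}.

Record cmod_hom (M N : cmodule) := CModHom {
  happ :> forall X, {additive M X -> N X};
  hnat : forall X Y (f : hom X Y) x,
    happ Y (mmap M f x) = mmap N f (happ X x)
}.

Lemma cmod_homP (M N : cmodule) (u v : cmod_hom M N) :
  (forall X, u X =1 v X) -> u = v.
Proof.
case: u v => u hu [v hv] /= uv.
have e : u = v by apply: functional_extensionality_dep => X; exact/addhomP/uv.
by subst v; congr CModHom; exact: Prop_irrelevance.
Qed.

Definition cmod_id (M : cmodule) : cmod_hom M M :=
  @CModHom M M (fun X => idfun) (fun X Y f x => erefl).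

Lemma cmod_comp_nat (M N L : cmodule) (v : cmod_hom N L) (u : cmod_hom M N)
    X Y (f : hom X Y) x :
  (v Y \o u Y) (mmap M f x) = mmap L f ((v X \o u X) x).
Proof. by rewrite /= !hnat. Qed.

Definition cmod_comp (M N L : cmodule) (v : cmod_hom N L) (u : cmod_hom M N) :
    cmod_hom M L :=
  @CModHom M L (fun X => v X \o u X) (cmod_comp_nat v u).

Lemma cmod_compA (M N L K : cmodule)
    (w : cmod_hom L K) (v : cmod_hom N L) (u : cmod_hom M N) :
  cmod_comp w (cmod_comp v u) = cmod_comp (cmod_comp w v) u.
Proof. exact: cmod_homP. Qed.

Lemma cmod_comp1l (M N : cmodule) (u : cmod_hom M N) :
  cmod_comp (cmod_id N) u = u.
Proof. exact: cmod_homP. Qed.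

Lemma cmod_comp1r (M N : cmodule) (u : cmod_hom M N) :
  cmod_comp u (cmod_id M) = u.
Proof. exact: cmod_homP. Qed.

Definition Mod : category :=
  Category cmod_compA cmod_comp1l cmod_comp1r.

Section Representable.
Variable X : C.

Section PostComp.
Variables (Y Z : C) (g : hom Y Z).

Definition postcomp (f : hom X Y) : hom X Z := comp g f.

Lemma postcomp_is_additive : nmod_morphism postcomp.
Proof. by split=> [|f f']; rewrite /postcomp ?comp0r ?compDr //. Qed.

HB.instance Definition _ :=
  GRing.isNmodMorphism.Build _ _ postcomp postcomp_is_additive.

End PostComp.

Definition rep : cmodule :=
  @CModule (fun Y => hom X Y : zmodType) (fun Y Z g => postcomp g)
    (fun Y f => comp1l f) (fun Y Z W h g f => esym (compA h g f))
    (fun Y Z g g' f => compDl g g' f).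

End Representable.

Definition exact_at (L M N : cmodule) (u : cmod_hom L M) (v : cmod_hom M N) :=
  forall X (y : M X), v X y = 0 <-> exists x : L X, u X x = y.

(* There is an exact sequence Hom(Y, -) -> Hom(X, -) -> M -> 0. *)
Definition finitely_presented (M : cmodule) : Prop :=
  exists (X Y : C) (u : cmod_hom (rep Y) (rep X)) (v : cmod_hom (rep X) M),
    exact_at u v /\ forall Z (y : M Z), exists x, v Z x = y.

Section Trace.
Variables (P N : cmodule) (X : C).

(* Sum at X of the images of all morphisms P -> N. *)
Definition trace : {pred N X} := fun x =>
  `[< exists s : seq (cmod_hom P N * P X), x = \sum_(u <- s) u.1 X u.2 >].

Lemma trace_closed : zmod_closed trace.
Proof.
split; first by apply/asboolP; exists [::]; rewrite big_nil.
move=> x y /asboolP[s ->] /asboolP[t ->]; apply/asboolP.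
exists (s ++ [seq (u.1, - u.2) | u <- t]).
rewrite big_cat big_map -sumrN /=; congr (_ + _).
by apply: eq_bigr => u _; rewrite raddfN.
Qed.

HB.instance Definition _ := GRing.isZmodClosed.Build (N X) trace trace_closed.

End Trace.

Section RValues.
Variables (M : cmodule) (X : C).

Lemma mmap0 (Y : C) x : mmap M (0 : hom X Y) x = 0.
Proof. by apply: (addIr (mmap M 0 x)); rewrite -mmapD !add0r. Qed.

(* An element a of R acts on M(X) as M(a . 1_X). *)
Definition rval : Type := M X.

HB.instance Definition _ := GRing.Zmodule.on rval.

Definition rscale (a : R) (x : rval) : rval := mmap M (a *: idm X) x.

Lemma rscaleA a b v : rscale a (rscale b v) = rscale (a * b) v.
Proof. by rewrite /rscale -mmapM compZl comp1l scalerA. Qed.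

Lemma rscale1 : left_id 1 rscale.
Proof. by move=> v; rewrite /rscale scale1r mmap1. Qed.

Lemma rscaleDr : right_distributive rscale +%R.
Proof. by move=> a x y; rewrite /rscale raddfD. Qed.

Lemma rscaleDl v : {morph rscale^~ v : a b / a + b}.
Proof. by move=> a b; rewrite /rscale scalerDl mmapD. Qed.

HB.instance Definition _ := GRing.Zmodule_isLmodule.Build R rval
  rscaleA rscale1 rscaleDr rscaleDl.

End RValues.

Section RLinear.
Variables (M : cmodule) (X Y : C) (f : hom X Y).

Definition rmap : rval M X -> rval M Y := mmap M f.

Lemma rmap_is_linear : linear rmap.
Proof.
move=> a x y; rewrite /rmap raddfD; congr (_ + _).
by rewrite /GRing.scale /= /rscale -!mmapM compZr compZl comp1l comp1r.
Qed.

HB.instance Definition _ :=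
  GRing.isLinear.Build R (rval M X) (rval M Y) _ rmap rmap_is_linear.

End RLinear.

Section RHom.
Variables (M N : cmodule) (u : cmod_hom M N) (X : C).

Definition rhom : rval M X -> rval N X := u X.

Lemma rhom_is_linear : linear rhom.
Proof.
move=> a x y; rewrite /rhom raddfD; congr (_ + _).
by rewrite /GRing.scale /= /rscale hnat.
Qed.

HB.instance Definition _ :=
  GRing.isLinear.Build R (rval M X) (rval N X) _ rhom rhom_is_linear.

End RHom.
End Varieties.

Arguments cmodule {R} C.
Arguments Mod {R} C.
Arguments mmap {R C} c {X Y} f.
Arguments rmap {R C} M {X Y} f.
Arguments rhom {R C M N} u X.
Arguments trace {R C} P N X.

Section Precompose.
Variables (R : comPzRingType) (U V E : lmodType R) (f : {linear U -> V}).

Definition precomp (phi : linhom V E) : linhom U E :=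
  (phi : {linear V -> E}) \o f.

Lemma precomp_is_additive : nmod_morphism precomp.
Proof. by split=> [|phi psi]; apply: linhomP. Qed.

HB.instance Definition _ :=
  GRing.isNmodMorphism.Build _ _ precomp precomp_is_additive.

End Precompose.

Section Duality.
Variables (R : comPzRingType) (E : lmodType R) (C : lincat R).

Section DualModule.
Variable M : cmodule C.

Let dval (X : op C) : zmodType := linhom (rval M X) E.

Let dmap (X Y : op C) (f : hom X Y) : {additive dval X -> dval Y} :=
  precomp (E := E) (rmap M (f : @hom R C Y X)).

Let dmap1 X x : dmap (idm X) x = x.
Proof. by apply: linhomP => y /=; rewrite /rmap mmap1. Qed.

Let dmapM X Y Z (g : hom Y Z) (f : hom X Y) x :
  dmap (comp g f) x = dmap g (dmap f x).
Proof. by apply: linhomP => y /=; rewrite /rmap mmapM. Qed.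

Let dmapD X Y (f g : hom X Y) x : dmap (f + g) x = dmap f x + dmap g x.
Proof. by apply: linhomP => y /=; rewrite /rmap mmapD raddfD. Qed.

Definition dual_module : cmodule (op C) := CModule dmap1 dmapM dmapD.

End DualModule.

Section DualHom.
Variables (M N : cmodule C) (u : cmod_hom M N).

Let dapp (X : op C) : {additive dual_module N X -> dual_module M X} :=
  precomp (E := E) (rhom u X).

Let dapp_nat (X Y : op C) (f : hom X Y) x :
  dapp Y (mmap (dual_module N) f x) = mmap (dual_module M) f (dapp X x).
Proof. by apply: linhomP => y /=; rewrite /rmap /rhom hnat. Qed.

Definition dual_hom : cmod_hom (dual_module N) (dual_module M) :=
  CModHom dapp_nat.

End DualHom.

Definition dual_functor : functor (opcat (Mod C)) (Mod (op C)).
Proof.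
refine (@Functor (opcat (Mod C)) (Mod (op C)) dual_module
  (fun M N u => @dual_hom N M u) _ _).
- by move=> M; apply: cmod_homP => X phi; apply: linhomP.
- by move=> M N L v u; apply: cmod_homP => X phi; apply: linhomP.
Defined.

(* The contravariant functor D_C restricts to an equivalence from the opposite
   of mod(C) to mod(C^op). *)
Definition dualizing : Prop :=
  exists fpD : forall M : opcat (Mod C),
      finitely_presented M -> finitely_presented (dual_functor M),
    equivalence (restr_functor fpD).

End Duality.

Record ideal (R : comPzRingType) (C : lincat R) := Ideal {
  imem : forall A B : C, zmodClosed (hom A B);
  imemL : forall A B D (g : hom B D) (f : hom A B),
    f \in imem A B -> comp g f \in imem A D;
  imemR : forall A B D (g : hom B D) (f : hom A B),
    g \in imem B D -> comp g f \in imem A D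
}.

Definition op_ideal (R : comPzRingType) (C : lincat R) (I : ideal C) :
    ideal (op C) :=
  @Ideal R (op C) (fun A B => imem I B A)
    (fun A B D g f => @imemR R C I D B A f g)
    (fun A B D g f => @imemL R C I D B A f g).

Section Subgroup.
Variables (V : zmodType) (S : zmodClosed V).

Definition subgroup : Type := {x : V | x \in S}.

HB.instance Definition _ := SubChoice.on subgroup.
HB.instance Definition _ := [SubChoice_isSubZmodule of subgroup by <:].

End Subgroup.

Section IdealFunctors.
Variables (R : comPzRingType) (C : lincat R) (I : ideal C) (A : C).

Section Map.
Variables (X Y : C) (g : hom X Y).

Definition ideal_map (f : subgroup (imem I A X)) : subgroup (imem I A Y) :=
  exist _ (comp g (val f)) (imemL g (valP f)).

Lemma ideal_map_is_additive : nmod_morphism ideal_map.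
Proof. by split=> [|f f']; apply: val_inj; rewrite /= ?comp0r ?compDr. Qed.

HB.instance Definition _ :=
  GRing.isNmodMorphism.Build _ _ ideal_map ideal_map_is_additive.

End Map.

Let ideal_map1 X x : ideal_map (idm X) x = x.
Proof. by apply: val_inj; rewrite /= comp1l. Qed.

Let ideal_mapM X Y Z (g : hom Y Z) (f : hom X Y) x :
  ideal_map (comp g f) x = ideal_map g (ideal_map f x).
Proof. by apply: val_inj; rewrite /= compA. Qed.

Let ideal_mapD X Y (f g : hom X Y) x :
  ideal_map (f + g) x = ideal_map f x + ideal_map g x.
Proof. by apply: val_inj; rewrite /= compDl. Qed.

Definition ideal_rep : cmodule C :=
  @CModule R C (fun X => subgroup (imem I A X)) (fun X Y g => ideal_map g)
    ideal_map1 ideal_mapM ideal_mapD.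

End IdealFunctors.

Definition ideal_corep (R : comPzRingType) (C : lincat R) (I : ideal C)
  (A : C) : cmodule (op C) := @ideal_rep R (op C) (op_ideal I) A.

Definition corep (R : comPzRingType) (C : lincat R) (Y : C) :
  cmodule (op C) := @rep R (op C) Y.

Definition propertyA (R : comPzRingType) (C : lincat R) (I : ideal C) : Prop :=
  forall C' : C, exists X Y : C,
    (exists u : @chom (Mod C) (rep X) (ideal_rep I C'), epi u) /\
    (exists v : @chom (Mod (op C)) (corep Y) (ideal_corep I C'), epi v).

Section TraceIdeal.
Variables (R : comPzRingType) (C : lincat R) (P : cmodule C).

Section RepMap.
Variables (A B : C) (h : hom A B).

Definition precompose (X : C) (f : hom B X) : hom A X := comp f h.

Lemma precompose_is_additive X : nmod_morphism (@precompose X).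
Proof. by split=> [|f f']; rewrite /precompose ?comp0l ?compDl. Qed.

HB.instance Definition _ X :=
  GRing.isNmodMorphism.Build _ _ (@precompose X) (precompose_is_additive X).

Definition rep_map : cmod_hom (rep B) (rep A) :=
  @CModHom R C (rep B) (rep A) (fun X => @precompose X)
    (fun X Y g f => esym (compA g f h)).

End RepMap.

Let tr (A B : C) : zmodClosed (hom A B) :=
  (trace P (rep A) B : zmodClosed (rep A B)).

Let trL A B D (g : hom B D) (f : hom A B) : f \in tr A B -> comp g f \in tr A D.
Proof.
move=> /asboolP[s ->]; apply/asboolP.
exists [seq (u.1, mmap P g u.2) | u <- s].
rewrite big_map -/(postcomp g _) raddf_sum.
by apply: eq_bigr => u _; rewrite hnat.
Qed.

Let trR A B D (g : hom B D) (f : hom A B) : g \in tr B D -> comp g f \in tr A D.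
Proof.
move=> /asboolP[s ->]; apply/asboolP.
exists [seq (cmod_comp (rep_map f) u.1, u.2) | u <- s].
by rewrite big_map -/(precompose f _) raddf_sum.
Qed.

(* (Tr_P C)(A, B) = Tr_P(Hom(A, -))(B). *)
Definition trace_ideal : ideal C := Ideal trL trR.

End TraceIdeal.

(* Main.v *)
From HB Require Import structures.
From mathcomp Require Import all_boot all_algebra.
From mathcomp Require Import boolp.
Require Import Defs.

(** By the Yoneda lemma, a morphism [A -> B] lies in the trace ideal of
    [Hom(C0, -)] exactly when it is a finite sum of composites
    [A -> C0 -> B] ([trace_idealP]).  This description is self-dual, so it is
    enough to cover the covariant functor [I(A, -)] by a representable one,
    and to read the result once in [C] and once in [C^op].

    An epimorphism [Hom(S, -) -> I(A, -)] amounts to a single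
    [alpha : A -> S] in [I] through which every element of every [I(A, X)]
    factors.  As [Hom(A, C0)] is a finitely generated [R]-module, the biproduct
    of copies of [C0] indexed by generators [a_1, ..., a_n] receives the
    morphism [alpha] with components [a_i] ([fin_gen_factor]).  Every [A -> C0]
    is then of the form [q alpha], hence so is every sum of composites
    [A -> C0 -> X]. *)

Set Implicit Arguments.
Unset Strict Implicit.
Unset Printing Implicit Defensive.

Import GRing.Theory.
Local Open Scope ring_scope.

Section Functors.
Variables (R : comPzRingType) (C : lincat R).

Section Yoneda.
Variables (M : cmodule C) (S : C) (m : M S).

Definition yoneda_app (X : C) (f : rep S X) : M X := mmap M f m.

Lemma yoneda_app_is_additive X : nmod_morphism (@yoneda_app X).
Proof. by split=> [|f g]; rewrite /yoneda_app ?mmap0 ?mmapD. Qed.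

HB.instance Definition _ X :=
  GRing.isNmodMorphism.Build _ _ (@yoneda_app X) (yoneda_app_is_additive X).

Definition yoneda : cmod_hom (rep S) M :=
  @CModHom R C (rep S) M (fun X => @yoneda_app X)
    (fun X Y g f => mmapM g f m).

End Yoneda.

Lemma cmod_hom_rep (M : cmodule C) (S X : C) (u : cmod_hom (rep S) M)
  (f : hom S X) : u X f = mmap M f (u S (idm S)).
Proof. by rewrite -hnat; congr (u X _); rewrite /= /postcomp comp1r. Qed.

Lemma surj_epi (M N : cmodule C) (u : cmod_hom M N) :
  (forall X (y : N X), exists x, u X x = y) -> @epi (Mod C) M N u.
Proof.
move=> su L g h gh; apply: cmod_homP => X y; have [x <-] := su X y.
exact: (congr1 (fun k : cmod_hom M L => k X x) gh).
Qed.

End Functors.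

(** The ideal of all morphisms that factor through a finite direct sum of
    copies of [Z]; sums of composites avoid choosing that direct sum. *)
Definition factor_ideal (R : comPzRingType) (C : lincat R) (I : ideal C)
    (Z : C) : Prop :=
  forall (A B : C) (f : hom A B), f \in imem I A B <->
    exists s : seq (hom Z B * hom A Z), f = \sum_(u <- s) comp u.1 u.2.

(** A morphism of functors [Hom(Z, -) -> Hom(A, -)] is precomposition with some
    [A -> Z], so each summand in the trace is a composite through [Z]. *)
Lemma trace_idealP (R : comPzRingType) (C : lincat R) (Z : C) :
  factor_ideal (trace_ideal (rep Z)) Z.
Proof.
move=> A B f; split=> [/asboolP[s ->]|[s ->]].
  exists [seq (u.2 : hom Z B, u.1 Z (idm Z) : hom A Z) |
           u : cmod_hom (rep Z) (rep A) * rep Z B <- s]; rewrite big_map.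
  by apply: eq_bigr => u _; exact: (cmod_hom_rep u.1 u.2).
apply/asboolP; exists [seq (rep_map u.2, u.1) | u <- s].
by rewrite big_map.
Qed.

Lemma factor_ideal_op (R : comPzRingType) (C : lincat R) (I : ideal C)
  (Z : C) : factor_ideal I Z -> factor_ideal (op_ideal I) (Z : op C).
Proof.
move=> IZ A B f; apply: (iff_trans (IZ B A f)).
by split=> -[s ->]; exists [seq (u.2, u.1) | u <- s]; rewrite big_map.
Qed.

Lemma additive_op (R : comPzRingType) (C : lincat R) :
  additive_category C -> additive_category (op C).
Proof.
move=> [[Z zZ] bC]; split; first by exists Z => X; have [] := zZ X.
move=> X Y; have [S [i1 [i2 [p1 [p2 [e11 e22 e12 e21 eS]]]]]] := bC X Y.
by exists S, p1, p2, i1, i2.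
Qed.

Section Covering.
Variables (R : comPzRingType) (C : lincat R).
Hypothesis addC : additive_category C.

(** Take for [S] the iterated biproduct of one copy of [Z] per entry of [s], and
    for [alpha] the morphism whose components are these entries: each entry is
    [alpha] followed by a projection. *)
Lemma seq_factor (I : ideal C) (A Z : C) (s : seq (hom A Z)) :
  (forall a, a \in s -> a \in imem I A Z) ->
  exists (S : C) (alpha : hom A S), alpha \in imem I A S /\
    forall a, a \in s -> exists q : hom S Z, a = comp q alpha.
Proof.
elim: s => [_|a s IHs sI].
  by have [O _] := addC.1; exists O, 0; split=> //; exact: rpred0.
have [|S [al [alI alP]]] := IHs.
  by move=> b bs; apply: sI; rewrite inE bs orbT.
have [T [i1 [i2 [p1 [p2 [e11 e22 e12 e21 _]]]]]] := addC.2 Z S.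
exists T, (comp i1 a + comp i2 al); split.
  by apply: rpredD; apply: imemL => //; apply: sI; rewrite mem_head.
move=> b; rewrite inE => /predU1P[->|/alP[q ->]].
  by exists p1; rewrite compDr !compA e11 e12 comp1l comp0l addr0.
exists (comp q p2).
by rewrite -compA compDr !(compA p2) e21 e22 comp0l comp1l add0r.
Qed.

Lemma fin_gen_factor (I : ideal C) (A Z : C) :
  fin_gen (hom A Z) -> (forall a : hom A Z, a \in imem I A Z) ->
  exists (S : C) (alpha : hom A S), alpha \in imem I A S /\
    forall a : hom A Z, exists q : hom S Z, a = comp q alpha.
Proof.
move=> [n [g gP]] allI.
have [|S [al [alI alP]]] := @seq_factor I A Z [seq g i | i <- enum 'I_n].
  by move=> a _; exact: allI.
exists S, al; split=> // a; have [c ->] := gP a.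
apply: (big_ind (fun b => exists q : hom S Z, b = comp q al)).
- by exists 0; rewrite comp0l.
- by move=> _ _ [q ->] [r ->]; exists (q + r); rewrite compDl.
move=> i _; have [|q ->] := alP (g i); first by rewrite map_f ?mem_enum.
by exists (c i *: q); rewrite compZl.
Qed.

Lemma factor_ideal_rep_epi (I : ideal C) (A Z : C) :
  factor_ideal I Z -> fin_gen (hom A Z) ->
  exists (S : C) (u : @chom (Mod C) (rep S) (ideal_rep I A)), epi u.
Proof.
move=> IZ fg.
have allI (a : hom A Z) : a \in imem I A Z.
  by apply/IZ; exists [:: (idm Z, a)]; rewrite big_seq1 comp1l.
have [S [al [alI alP]]] := fin_gen_factor fg allI.
exists S, (@yoneda _ _ (ideal_rep I A) S (exist _ al alI)).
apply: surj_epi => X [f fI].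
suff [g fE] : exists g : hom S X, f = comp g al.
  by exists g; apply: val_inj; exact: esym fE.
have [s ->] := (IZ A X f).1 fI.
apply: (big_ind (fun b => exists g : hom S X, b = comp g al)).
- by exists 0; rewrite comp0l.
- by move=> _ _ [q ->] [r ->]; exists (q + r); rewrite compDl.
by move=> u _; have [q ->] := alP u.2; exists (comp u.1 q); rewrite compA.
Qed.

End Covering.

Theorem proposition6p10 (R : comPzRingType) (E : lmodType R) (C : lincat R)
    (C0 : C) :
  artinian R ->
  injective_envelope (top_module R) E ->
  hom_finite_variety C ->
  dualizing E C ->
  propertyA (trace_ideal (rep C0)).
Proof.
move=> _ _ [addC _ fgC] _ A.
have IC0 := @trace_idealP R C C0.
have [X epiX] := factor_ideal_rep_epi addC IC0 (fgC A C0).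
have [Y epiY] := @factor_ideal_rep_epi R (op C) (additive_op addC) _ A C0
  (factor_ideal_op IC0) (fgC C0 A).
by exists X, Y; split.
Qed.
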